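(* Let $\mathcal R$ be a commutative ring with unit, let $L\in\mathbb N_0$, and let $\vec m=(m_0,m_1,\dots,m_L)\in\mathcal R^{L+1}$. For every $n\in\mathbb N_0$ and every $i\in\{0,1,\dots,L\}$ let $\Theta_{n,i}:\Delta_n\to\Delta_n$ be a homeomorphism. Assume that for every $n\in\mathbb N$, all $i,k\in\{0,1,\dots,L\}$ and all $j,p\in\{0,1,\dots,n\}$ with $j\le p$ the following equality of maps $\Delta_{n-1}\to\Delta_{n+1}$ holds: $$\langle id\rangle_{n+1,i,j}\circ\Theta_{n,i}\circ\langle id\rangle_{n,k,p}\circ\Theta_{n-1,k}\;=\;\langle id\rangle_{n+1,k,p+1}\circ\Theta_{n,k}\circ\langle id\rangle_{n,i,j}\circ\Theta_{n-1,i}.$$ Then for every topological space $X$, every $n\in\mathbb N_0$ and every continuous map $T:\Delta_{n+1}\to X$, $${}_{\vec m}\partial_n\circ{}_{\vec m}\partial_{n+1}(T)=0 .$$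
   Context: $\mathbb N=\{1,2,3,\dots\}$, $\mathbb N_0=\mathbb N\cup\{0\}$. $\Delta_n=\{(x_0,\dots,x_n)\in\mathbb R^{n+1}\mid 0\le x_j\le 1 \text{ for all } j,\ \sum_{j=0}^n x_j=1\}$ with the Euclidean topology. For a topological space $X$ let $\mathcal{SS}_n(X)$ be the set of continuous maps $T:\Delta_n\to X$, let $\mathcal F(\mathcal R)_n(X)$ be the free $\mathcal R$-module with basis $\mathcal{SS}_n(X)$ for $n\in\mathbb N_0$, and $\mathcal F(\mathcal R)_{-1}(X):=\{0\}$. For $n\in\mathbb N$, $T\in\mathcal{SS}_n(X)$, $i\in\{0,\dots,L\}$, $j\in\{0,\dots,n\}$, define $\langle T\rangle_{n,i,j}\in\mathcal{SS}_{n-1}(X)$ (the dependence on the fixed $L$ is suppressed) by $$\langle T\rangle_{n,i,j}(x_0,\dots,x_{n-1}):=T(y_0,\dots,y_{j-1},v,y_j,\dots,y_{n-1}),\quad v:=\frac{i}{(L+1)(n+1)},\quad y_k:=(1-v)\,x_k .$$ Thus $v$ is inserted as the component with index $j$. $\langle id\rangle_{n,i,j}:\Delta_{n-1}\to\Delta_n$ is this map for $T=id_{\Delta_n}$. For $n\in\mathbb N$ the map ${}_{\vec m}\partial_n:\mathcal F(\mathcal R)_n(X)\to\mathcal F(\mathcal R)_{n-1}(X)$ is the $\mathcal R$-linear map given on basis elements by $${}_{\vec m}\partial_n(T):=\sum_{j=0}^n(-1)^j\sum_{i=0}^L m_i\cdot\big[\langle T\rangle_{n,i,j}\circ\Theta_{n-1,i}\big],$$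 and ${}_{\vec m}\partial_0:=0$. *)

(* Defs.v *)
From HB Require Import structures.
From mathcomp Require Import all_boot all_order all_algebra finmap.
From mathcomp Require Import all_classical all_reals all_analysis.
Import Order.TTheory GRing.Theory Num.Theory numFieldNormedType.Exports.

Set Implicit Arguments.
Unset Strict Implicit.
Unset Printing Implicit Defensive.

Local Open Scope classical_set_scope.
Local Open Scope ring_scope.

(* The free A-module on an arbitrary set K: finitely supported functions from
   K to A. The coefficient ring is allowed to be trivial, which the free
   modules of the multinomials library exclude. *)
Definition free_mod (A : pzRingType) (K : choiceType) : Type :=
  {fsfun K -> A with 0}.

Section FreeModule.
Variables (A : pzRingType) (K : choiceType).
Local Notation F := (free_mod A K).
Implicit Types (u v w : F) (a b : A) (k : K).

HB.instance Definition _ := Choice.on F.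

Definition fcoef u k : A := (u : {fsfun K -> A with 0}) k.
Definition fsupp u : {fset K} := finsupp (u : {fsfun K -> A with 0}).

Lemma fcoefP u v : fcoef u =1 fcoef v -> u = v.
Proof. exact: (iffLR (fsfunP _ _)). Qed.

Lemma fcoef_supp u k : k \notin fsupp u -> fcoef u k = 0.
Proof. exact: fsfun_dflt. Qed.

Definition fzero : F := [fsfun].
Definition fopp u : F := [fsfun k in fsupp u => - fcoef u k].
Definition fadd u v : F :=
  [fsfun k in (fsupp u `|` fsupp v)%fset => fcoef u k + fcoef v k].
Definition fscale a u : F := [fsfun k in fsupp u => a * fcoef u k].

Definition basis k : F := [fsfun j in [fset k]%fset => 1].

Lemma fcoef_zero k : fcoef fzero k = 0.
Proof. by rewrite /fcoef fsfun0E. Qed.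

Lemma fcoef_opp u k : fcoef (fopp u) k = - fcoef u k.
Proof.
rewrite /fcoef fsfunE; case: ifPn => // kNu.
by rewrite -/(fcoef u k) (fcoef_supp kNu) oppr0.
Qed.

Lemma fcoef_add u v k : fcoef (fadd u v) k = fcoef u k + fcoef v k.
Proof.
rewrite /fcoef fsfunE; case: ifPn => //; rewrite inE negb_or => /andP[ku kv].
by rewrite -/(fcoef u k) -/(fcoef v k) (fcoef_supp ku) (fcoef_supp kv) addr0.
Qed.

Lemma fcoef_scale a u k : fcoef (fscale a u) k = a * fcoef u k.
Proof.
rewrite /fcoef fsfunE; case: ifPn => // kNu.
by rewrite -/(fcoef u k) (fcoef_supp kNu) mulr0.
Qed.

Lemma fcoef_basis k j : fcoef (basis k) j = (j == k)%:R.
Proof. by rewrite /fcoef fsfunE inE; case: eqP. Qed.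

Let fcoefE := (fcoef_zero, fcoef_opp, fcoef_add, fcoef_scale).

Fact faddA : associative fadd.
Proof. by move=> u v w; apply: fcoefP => k; rewrite !fcoefE addrA. Qed.
Fact faddC : commutative fadd.
Proof. by move=> u v; apply: fcoefP => k; rewrite !fcoefE addrC. Qed.
Fact fadd0 : left_id fzero fadd.
Proof. by move=> u; apply: fcoefP => k; rewrite !fcoefE add0r. Qed.
Fact faddN : left_inverse fzero fopp fadd.
Proof. by move=> u; apply: fcoefP => k; rewrite !fcoefE addNr. Qed.
HB.instance Definition _ := GRing.isZmodule.Build F faddA faddC fadd0 faddN.

Fact fscaleA a b u : fscale a (fscale b u) = fscale (a * b) u.
Proof. by apply: fcoefP => k; rewrite !fcoefE mulrA. Qed.
Fact fscale1 : left_id 1 fscale.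
Proof. by move=> u; apply: fcoefP => k; rewrite !fcoefE mul1r. Qed.
Fact fscaleDr : right_distributive fscale +%R.
Proof.
by move=> a u v; apply: fcoefP => k; rewrite [LHS]fcoefE !fcoefE mulrDr.
Qed.
Fact fscaleDl v : {morph fscale^~ v : a b / a + b}.
Proof. by move=> a b; apply: fcoefP => k; rewrite !fcoefE mulrDl. Qed.
HB.instance Definition _ :=
  GRing.Zmodule_isLmodule.Build A F fscaleA fscale1 fscaleDr fscaleDl.

Section LinearExtension.
Variables (M : lmodType A) (f : K -> M).

Definition lin_ext u : M := \sum_(k <- fsupp u) fcoef u k *: f k.

Lemma lin_extE (S : {fset K}) u : (fsupp u `<=` S)%fset ->
  lin_ext u = \sum_(k <- S) fcoef u k *: f k.
Proof.
move=> uS; apply: big_fset_incl => // k _ kNu.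
by rewrite (fcoef_supp kNu) scale0r.
Qed.

Fact lin_ext_linear : linear lin_ext.
Proof.
move=> a u v; pose S := (fsupp (a *: u + v)%R `|` (fsupp u `|` fsupp v))%fset.
rewrite (@lin_extE S) ?fsubsetUl// (@lin_extE S u); last first.
  by rewrite /S fsetUCA fsubsetUl.
rewrite (@lin_extE S v); last by rewrite /S fsetUA fsubsetUr.
rewrite scaler_sumr -big_split/=; apply: eq_bigr => k _.
by rewrite fcoef_add fcoef_scale scalerDl scalerA.
Qed.
HB.instance Definition _ :=
  GRing.isLinear.Build A F M *:%R lin_ext lin_ext_linear.

Lemma lin_ext_basis k : lin_ext (basis k) = f k.
Proof.
rewrite (@lin_extE [fset k]%fset) ?big_seq_fset1 ?fcoef_basis ?eqxx ?scale1r//.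
apply/fsubsetP => j; apply: contraLR => jk.
by rewrite mem_finsupp negbK fsfunE (negPf jk).
Qed.

End LinearExtension.
End FreeModule.

(* Used as a type, this set carries the topology induced from R^(n+1). *)
Definition simplex (R : realType) (n : nat) : set 'rV[R]_n.+1 :=
  [set x | (forall j, 0 <= x ord0 j <= 1) /\ \sum_j x ord0 j = 1].
Arguments simplex : clear implicits.

Section Simplex.
Variable R : realType.

(* <id>_{n+1,i,j} : Delta_n -> Delta_(n+1), inserting the value
   v = i / ((L+1)(n+2)) at index j. [unlift j k] is [None] for k = j, and
   otherwise [Some k'] with k' the position of k once the index j is skipped. *)
Definition insert_val (L n : nat) (i : 'I_L.+1) : R := i%:R / (L.+1 * n.+2)%:R.

Definition insert_row (L n : nat) (i : 'I_L.+1) (j : 'I_n.+2)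
    (x : 'rV[R]_n.+1) : 'rV[R]_n.+2 :=
  \row_k if unlift j k is Some k' then (1 - insert_val n i) * x ord0 k'
         else insert_val n i.

Lemma insert_val_ge0 L n (i : 'I_L.+1) : 0 <= insert_val n i.
Proof. by rewrite divr_ge0 ?ler0n. Qed.

Lemma insert_val_le1 L n (i : 'I_L.+1) : insert_val n i <= 1.
Proof.
rewrite /insert_val ler_pdivrMr ?ltr0n// mul1r ler_nat.
by rewrite (leq_trans (ltnW (ltn_ord i)))// leq_pmulr.
Qed.

Lemma insert_row_simplex L n (i : 'I_L.+1) (j : 'I_n.+2) (x : simplex R n) :
  insert_row i j (\val x) \in simplex R n.+1.
Proof.
have v0 := insert_val_ge0 n i; have v1 := insert_val_le1 n i.
have [x01 xS] := set_mem (valP x).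
apply/mem_set; split=> [k|].
  rewrite mxE; case: unliftP => [k' _|_]; last by rewrite v0.
  have /andP[x0 x1] := x01 k'.
  by rewrite mulr_ge0 ?subr_ge0//= mulr_ile1 ?subr_ge0// gerBl.
rewrite (bigD1_ord j)//= mxE unlift_none.
under eq_bigr do rewrite mxE liftK.
by rewrite -mulr_sumr xS mulr1 addrC subrK.
Qed.

Definition insert L n (i : 'I_L.+1) (j : 'I_n.+2) (x : simplex R n) :
  simplex R n.+1 := SigSub (insert_row_simplex i j x).

Lemma insert_continuous L n (i : 'I_L.+1) (j : 'I_n.+2) :
  continuous (insert i j).
Proof.
have : continuous (set_val \o insert i j); last first.
  exact: continuous_comp_initial.
move=> x A /= [P xP PA].
have nx : Filter (nbhs x) by exact: nbhs_filter.
suff Prow : \forall y \near x, forall a k,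
    P a k (insert_row i j (\val y) a k).
  by apply: filterS Prow => y; exact: PA.
apply: (@filter_forall _ _ _ (nbhs x)) => a.
apply: (@filter_forall _ _ _ (nbhs x)) => k.
suff : {for x, continuous (fun y : simplex R n => insert_row i j (\val y) a k)}.
  by apply; exact: xP.
under [X in {for _, continuous X}]funext do rewrite mxE.
case: (unlift j k) => [k'|]; last exact: cvg_cst.
apply: cvgMr; apply: (@continuous_comp _ _ _ set_val
  (fun y : 'rV[R]_n.+1 => y ord0 k')).
  exact: initial_continuous.
exact: coord_continuous.
Qed.

HB.instance Definition _ L n (i : 'I_L.+1) (j : 'I_n.+2) :=
  isContinuous.Build (simplex R n) (simplex R n.+1) (insert i j)
     (@insert_continuous L n i j).

(* <T>_{n+1,i,j} for T : Delta_(n+1) -> X. *)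
Definition face (X : topologicalType) (L n : nat)
    (T : continuousType (simplex R n.+1) X) (i : 'I_L.+1) (j : 'I_n.+2) :
  continuousType (simplex R n) X := T \o insert i j.

End Simplex.

Definition homeomorphism (X Y : topologicalType) (f : X -> Y) : Prop :=
  continuous f /\
  exists g : Y -> X, [/\ continuous g, cancel f g & cancel g f].

Section Boundary.
Variables (R : realType) (A : comPzRingType) (X : topologicalType).

Definition chains (n : nat) : lmodType A :=
  free_mod A (continuousType (simplex R n) X).

(* The chains in degree n - 1, which for n = 0 form the zero module. *)
Definition chains_pred (n : nat) : lmodType A :=
  if n is n'.+1 then chains n' else 'rV[A]_0.

Definition singular (n : nat) (T : continuousType (simplex R n) X) : chains n :=
  @basis A (continuousType (simplex R n) X) T.

Variables (L : nat) (m : 'rV[A]_L.+1).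
Variable Theta :
  forall n, 'I_L.+1 -> continuousType (simplex R n) (simplex R n).

Definition boundary_simplex (n : nat)
    (T : continuousType (simplex R n.+1) X) : chains n :=
  \sum_(j < n.+2) (-1) ^+ j *:
    \sum_(i < L.+1) m ord0 i *: singular (face T i j \o Theta n i).

Definition boundary (n : nat) : chains n -> chains_pred n :=
  if n is n'.+1 return chains n -> chains_pred n
  then lin_ext (@boundary_simplex n') else fun=> 0.

End Boundary.

Arguments singular {R} A {X n} T.
Arguments boundary {R A X L} m Theta n _.

(* Main.v *)
(* Expanding both boundaries gives the sum of (-1)^(j+p) m_i m_k times the
   iterated face with indices (i,j), (k,p). The hypothesis pairs the term
   (i,j),(k,p) with j <= p with the term (k,p+1),(i,j) of opposite sign, so
   everything cancels once the sums over i and k are exchanged. *)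
Require Import Defs.
From mathcomp Require Import all_boot all_order all_algebra.
From mathcomp Require Import all_classical all_reals all_analysis.
Import Order.TTheory GRing.Theory Num.Theory numFieldNormedType.Exports.

Set Implicit Arguments.
Unset Strict Implicit.
Unset Printing Implicit Defensive.

Local Open Scope ring_scope.

(** Cut along [j <= p], the index square falls into two triangles; [Gswap] matches them with signs
    differing by one factor -1. *)
Lemma alternating_double_sum_eq0 (A : pzRingType) (V : lmodType A) (n : nat)
    (G : 'I_n.+1 -> 'I_n -> V)
    (Gswap : forall j p : 'I_n, (j <= p)%N ->
      G (widen_ord (leqnSn n) j) p = G (lift ord0 p) j) :
  \sum_(j < n.+1) \sum_(p < n) (-1) ^+ (j + p) *: G j p = 0.
Proof.
under eq_bigr => j _ do rewrite (bigID (fun p : 'I_n => (j <= p)%N)) /=.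
(* The row [j = n] has no [p] with [j <= p], and the row [j = 0] none with [p < j]. Dropping each
   leaves both outer sums over ['I_n]. *)
rewrite big_split /= big_ord_recr /= [X in _ + X + _]big_pred0; last first.
  by move=> p; apply/negbTE; rewrite -ltnNge.
rewrite addr0 [X in _ + X]big_ord_recl [X in _ + (X + _)]big_pred0 // add0r.
rewrite [X in _ + X](exchange_big_dep xpredT) //= -big_split big1 //= => j _.
under [X in _ + X]eq_bigl => p do rewrite -ltnNge ltnS.
rewrite -big_split big1 //= => p jp.
by rewrite Gswap // (addnC _ j) addnS exprS mulN1r scaleNr subrr.
Qed.

Theorem theorem1 (R : realType) (A : comPzRingType) (L : nat)
    (m : 'rV[A]_L.+1)
    (Theta : forall n, 'I_L.+1 -> continuousType (simplex R n) (simplex R n))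
    (Theta_homeo : forall n i, homeomorphism (Theta n i))
    (Theta_face : forall (n : nat) (i k : 'I_L.+1) (j p : 'I_n.+2),
      (j <= p)%N ->
      face idfun i (widen_ord (leqnSn n.+2) j) \o Theta n.+1 i
        \o face idfun k p \o Theta n k =
      face idfun k (lift ord0 p) \o Theta n.+1 k
        \o face idfun i j \o Theta n i)
    (X : topologicalType) (n : nat)
    (T : continuousType (simplex R n.+1) X) :
  boundary m Theta n (boundary m Theta n.+1 (singular A T)) = 0.
Proof.
case: n T => [//|n] T /=.
rewrite lin_ext_basis /boundary_simplex linear_sum.
(* Collect the sign as [(-1) ^+ (j + p)], leaving the sums over [i] and [k] inside as [G j p]. *)
under eq_bigr => j _.
  rewrite linearZ linear_sum /=.
  under eq_bigr => i _ do
    rewrite linearZ /= lin_ext_basis scaler_sumr.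
  rewrite exchange_big scaler_sumr.
  under eq_bigr => p _.
    under eq_bigr => i _ do rewrite scalerA mulrC -scalerA.
    rewrite -scaler_sumr scalerA -exprD.
    over.
  over.
apply: alternating_double_sum_eq0 => j p jp.
under eq_bigr do rewrite scaler_sumr.
under [RHS]eq_bigr do rewrite scaler_sumr.
rewrite [RHS]exchange_big; apply: eq_bigr => i _; apply: eq_bigr => k _ /=.
rewrite !scalerA mulrC; congr (_ *: singular A _).
(* A face of [T] is [T] after a face of the identity, so applying [T] to [Theta_face] pointwise
   suffices. *)
apply/continuousEP => x /=.
by have /(congr1 (fun f => T (f x))) := Theta_face n i k j p jp.
Qed.
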